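(* Let $a, b \in \mathbb{N}$ be positive integers with $a + b > 4$, and let $x$ be a real number with $x > 1.8$. Then $$P_a(x)\, P_b(x) > P_{a+b}(x).$$
   Context: $\mathbb{N} = \{1,2,3,\ldots\}$. For a positive integer $k$, $\sigma(k) := \sum_{d \mid k} d$ is the sum of the positive divisors of $k$. The D'Arcais polynomials (also called Nekrasov--Okounkov polynomials) $P_n(x)$, $n \geq 0$, are defined recursively by $P_0(x) = 1$ and, for $n \geq 1$, $$P_n(x) := \frac{x}{n} \sum_{k=1}^{n} \sigma(k)\, P_{n-k}(x).$$ *)

(* Defs.v *)
From mathcomp Require Import all_boot all_order all_algebra.

Set Implicit Arguments.
Unset Strict Implicit.
Unset Printing Implicit Defensive.

Import GRing.Theory.
Local Open Scope ring_scope.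

Definition sigma (k : nat) : nat := (\sum_(d <- divisors k) d)%N.

(* Course-of-values recursion: [darcais_seq R n] is the list                  *)
(* [:: P_n; P_(n-1); ... ; P_0], so the entry of index k in                   *)
(* [darcais_seq R m] is P_(m-k), that is P_(n-(k+1)) when n = m+1.            *)
Fixpoint darcais_seq (R : numFieldType) (n : nat) : seq {poly R} :=
  match n with
  | 0 => [:: 1]
  | m.+1 =>
      let s := darcais_seq R m in
      (m.+1%:R^-1 *: ('X * \sum_(k < m.+1) (sigma k.+1)%:R *: s`_k)) :: s
  end.

Definition darcais (R : numFieldType) (n : nat) : {poly R} :=
  head 0 (darcais_seq R n).

Lemma nth_darcais_seq (R : numFieldType) (n k : nat) :
  (k <= n)%N -> (darcais_seq R n)`_k = darcais R (n - k).
Proof.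
elim: n k => [|n IHn] [|k] //= le_kn.
by rewrite subSS IHn.
Qed.

Lemma darcais0 (R : numFieldType) : darcais R 0 = 1.
Proof. by []. Qed.

Lemma darcais_rec (R : numFieldType) (n : nat) (x : R) : (0 < n)%N ->
  (darcais R n).[x] =
    x / n%:R * \sum_(1 <= k < n.+1) (sigma k)%:R * (darcais R (n - k)).[x].
Proof.
case: n => // n _; rewrite big_add1 big_mkord /= {1}/darcais /=.
rewrite hornerZ mulrC hornerM hornerX horner_sum mulrAC; congr (_ * _).
apply: eq_bigr => k _; rewrite hornerZ subSS nth_darcais_seq //.
by rewrite -ltnS.
Qed.

(* Main.v *)
(* Applying the recursion to P_a and to P_(a+b) gives, with                   *)
(* D(i, j) = P_i P_j - P_(i+j),                                               *)
(*   (a + b) D(a, b) = x * (\sum_(1 <= k <= a) sigma(k) D(a-k, b)             *)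
(*       + \sum_(1 <= k <= b) (sigma(k) P_a - sigma(a+k)) P_(b-k)).           *)
(* Take b <= a and induct on a + b. For a >= 4 the cubic bound P_a >= a^3 / 5 *)
(* beats sigma(n) <= n(n+1)/2, so the second sum is nonnegative termwise. In  *)
(* the first sum only D(1, j), D(2, 1) and D(3, 1) with j <= 3 can be         *)
(* negative, and they are bounded below by small constants, which the k = 1   *)
(* term of the second sum absorbs. The pairs (3, 2) and (3, 3) are checked    *)
(* directly.                                                                  *)

Require Import Defs.
From mathcomp Require Import all_boot all_order all_algebra.
From mathcomp Require Import reals.
From mathcomp Require Import zify ring lra.

Import Order.TTheory GRing.Theory Num.Theory.
Local Open Scope ring_scope.

(** Growth of P_n is played against the slow growth of sigma. The identity [darcais_sub] reduces
    D(a, b) > 0 to comparing P_a with values of sigma. Lower bounds on P_a come from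
    [darcais_table_le] for small indices and from [darcais_ge_cube] in general. For a >= 4,
    [sigma_shift_le] controls the second sum and [sigma_window_lt] pays for the negative part of the
    first. All estimates hold from x = 9/5 on, and strictness comes from [sigma_window_lt] and the
    explicit small pairs. *)

(** * Elementary bounds on sigma *)

Lemma leq_sigma (n : nat) : (0 < n)%N -> (n <= sigma n)%N.
Proof.
move=> n0; rewrite /sigma (big_rem n) ?leq_addr //=.
by rewrite -dvdn_divisors.
Qed.

Lemma sigmaE (n : nat) : sigma n = sumn (divisors n).
Proof. by rewrite sumnE. Qed.

(* [sigma 0 = 1], since [divisors 0 = [:: 1]]. *)
Lemma sigma_leq (n : nat) : (0 < n)%N -> (2 * sigma n <= n * n.+1)%N.
Proof.
case: n => [//|n] _.
have -> : (sigma n.+1 = \sum_(0 <= d < n.+2 | d %| n.+1) d)%N.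
  rewrite -[RHS]big_filter; apply/perm_big/uniq_perm.
  - exact: divisors_uniq.
  - exact/filter_uniq/iota_uniq.
  move=> d; rewrite mem_filter mem_index_iota -dvdn_divisors //=.
  by rewrite ltnS; case: (boolP (d %| _)%N) => // /dvdn_leq ->.
have : (\sum_(0 <= d < n.+2 | d %| n.+1) d <= \sum_(0 <= d < n.+2) d)%N.
  by rewrite big_mkcond leq_sum // => d _; case: ifP.
rewrite bin2_sum bin2 /= => h.
apply: leq_trans (leq_mul (leqnn 2) h) _.
by lia.
Qed.

(** * The recursion and the identity for D(a, b) *)

Section Darcais.
Context {R : realFieldType}.
Implicit Type x : R.

Lemma darcais_mul_rec (n : nat) x :
  n%:R * (darcais R n).[x] =
    x * \sum_(1 <= k < n.+1) (sigma k)%:R * (darcais R (n - k)).[x].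
Proof.
case: n => [|n]; first by rewrite mul0r big_geq // mulr0.
by rewrite darcais_rec // mulrA [_ * (x / _)]mulrC divfK // pnatr_eq0.
Qed.

(** Split (a + b) P_a P_b as (a P_a) P_b + P_a (b P_b) and expand by the recursion. The sum for
    P_(a+b), cut at k = a, has a head matching the first product and a tail, shifted by a, matching
    the second. *)
Lemma darcais_sub (a b : nat) x :
  (a + b)%:R * ((darcais R a).[x] * (darcais R b).[x] - (darcais R (a + b)).[x])
  = x * (\sum_(1 <= k < a.+1) (sigma k)%:R *
           ((darcais R (a - k)).[x] * (darcais R b).[x]
            - (darcais R (a + b - k)).[x])
         + \sum_(1 <= k < b.+1)
             ((sigma k)%:R * (darcais R a).[x] - (sigma (a + k))%:R)
             * (darcais R (b - k)).[x]).
Proof.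
rewrite mulrBr darcais_mul_rec natrD.
rewrite (@big_cat_nat _ _ _ a.+1) //=; last by rewrite ltnS leq_addr.
have -> : \sum_(a.+1 <= k < (a + b).+1)
      (sigma k)%:R * (darcais R (a + b - k)).[x]
    = \sum_(1 <= k < b.+1) (sigma (a + k))%:R * (darcais R (b - k)).[x].
  rewrite -[a.+1]add1n -addnS addnC addnC big_addn addKn.
  by apply: eq_big_nat => k _; rewrite addnC subnDl.
have -> : \sum_(1 <= k < a.+1) (sigma k)%:R *
           ((darcais R (a - k)).[x] * (darcais R b).[x]
            - (darcais R (a + b - k)).[x])
   = (\sum_(1 <= k < a.+1) (sigma k)%:R * (darcais R (a - k)).[x])
      * (darcais R b).[x]
     - \sum_(1 <= k < a.+1) (sigma k)%:R * (darcais R (a + b - k)).[x].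
  by rewrite mulr_suml -sumrB; apply: eq_bigr => k _; rewrite mulrBr mulrA.
have -> : \sum_(1 <= k < b.+1)
             ((sigma k)%:R * (darcais R a).[x] - (sigma (a + k))%:R)
             * (darcais R (b - k)).[x]
   = (\sum_(1 <= k < b.+1) (sigma k)%:R * (darcais R (b - k)).[x])
      * (darcais R a).[x]
     - \sum_(1 <= k < b.+1) (sigma (a + k))%:R * (darcais R (b - k)).[x].
  by rewrite mulr_suml -sumrB; apply: eq_bigr => k _; rewrite mulrBl mulrAC.
have ra := darcais_mul_rec a x; have rb := darcais_mul_rec b x.
by ring: ra rb.
Qed.

(** * Growth of P_n(x) for x >= 9/5 *)

(* The entry of index [n] is a lower bound for [100 P_n(9/5)]. *)
Definition darcais_table : seq nat :=
  [:: 100; 180; 432; 823; 1592; 2753; 4837; 7914; 12969; 20442; 31984; 48727]%N.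

(** Scaled by 100 and with 9/5 in place of x, the recursion becomes an integer inequality between
    table entries, checked by computation. *)
Lemma darcais_table_le (n : nat) x : 9%:R / 5%:R <= x -> (n < 12)%N ->
  (nth 0%N darcais_table n)%:R / 100%:R <= (darcais R n).[x].
Proof.
move=> hx; elim/ltn_ind: n => -[|n] IHn lt_n.
  by rewrite darcais0 hornerE /=; lra.
have tab : (5 * n.+1 * nth 0 darcais_table n.+1 <=
   9 * \sum_(1 <= k < n.+2) sigma k * nth 0 darcais_table (n.+1 - k))%N.
  under eq_bigr => k _ do rewrite sigmaE.
  rewrite unlock; clear IHn; do 11 (case: n lt_n => [|n] lt_n; first by vm_compute).
  by [].
rewrite -(@ler_pM2l _ n.+1%:R) // darcais_mul_rec.
have le_sum : (\sum_(1 <= k < n.+2)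
      sigma k * nth 0%N darcais_table (n.+1 - k))%:R / 100%:R <=
    \sum_(1 <= k < n.+2) (sigma k)%:R * (darcais R (n.+1 - k)).[x] :> R.
  rewrite natr_sum mulr_suml; apply: ler_sum_nat => k /andP[k0 kn].
  rewrite natrM -mulrA ler_wpM2l ?ler0n // IHn //; lia.
set S := bigop _ _ _ in tab le_sum; set T := bigop _ _ _ in le_sum *.
have {tab} : (5 * n.+1 * nth 0 darcais_table n.+1)%:R <= (9 * S)%:R :> R.
  by rewrite ler_nat.
rewrite !natrM => tab.
have S0 : 0 <= S%:R :> R by rewrite ler0n.
move: (nth 0%N darcais_table n.+1)%:R (n.+1)%:R tab => t m.
move: S%:R le_sum S0 => s *; nra.
Qed.

(** It is applied at y = m, to the recursion sum with cubes for P_j and k for sigma(k); y stays free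
    because the induction on m needs it fixed. *)
Lemma sum_expr3_mul (m : nat) (y : R) :
  60%:R * \sum_(0 <= j < m) j%:R ^+ 3 * (y - j%:R) =
  m%:R * (m%:R - 1) *
   (15%:R * m%:R * (m%:R - 1) * y
    - 2%:R * (2%:R * m%:R - 1) * (3%:R * m%:R ^+ 2 - 3%:R * m%:R - 1)).
Proof.
elim: m => [|m IHm]; first by rewrite big_geq // mulr0 !mul0r.
by rewrite big_nat_recr //= mulrDr IHm -natr1; ring.
Qed.

(** Induction and sigma(k) >= k give n P_n >= (9/25) (3 n^5 - 5 n^3 + 2 n) / 60. Its leading term
    0.018 n^5 exceeds n^4 / 5 only from n = 12 on, hence the length of the table. *)
Lemma darcais_ge_cube (n : nat) x : 9%:R / 5%:R <= x ->
  n%:R ^+ 3 / 5%:R <= (darcais R n).[x].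
Proof.
move=> hx; elim/ltn_ind: n => n IHn.
have [lt_n|ge_n] := ltnP n 12.
  apply: le_trans (darcais_table_le _ _ hx lt_n).
  have : (20 * n ^ 3 <= nth 0 darcais_table n)%N.
    by clear IHn; do 12 (case: n lt_n => [|n] lt_n; first by vm_compute).
  rewrite -(@ler_nat R) natrM natrX; lra.
have n0 : 0 < n%:R :> R by rewrite ltr0n; lia.
rewrite -(@ler_pM2l _ n%:R) // darcais_mul_rec.
have : (\sum_(0 <= j < n) j%:R ^+ 3 * (n%:R - j%:R)) / 5%:R <=
  \sum_(1 <= k < n.+1) (sigma k)%:R * (darcais R (n - k)).[x] :> R.
  rewrite big_add1 /= mulr_suml big_nat_rev /=.
  apply: ler_sum_nat => k /andP[_ kn]; rewrite add0n.
  have -> : n%:R - (n - k.+1)%:R = k.+1%:R :> R by rewrite natrB //; ring.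
  rewrite mulrAC mulrC; apply: ler_pM; rewrite ?ler0n ?ler_nat ?leq_sigma //.
    by rewrite divr_ge0 ?exprn_ge0 ?ler0n.
  by apply: IHn; lia.
have := sum_expr3_mul n n%:R.
have : 12%:R <= n%:R :> R by rewrite ler_nat.
move: (\sum_(0 <= j < _) _) (\sum_(1 <= k < _) _) => s t.
move: n%:R n0 => m m0 m12 hs hst.
have hs' : 60%:R * s = 3%:R * m ^+ 5 - 5%:R * m ^+ 3 + 2%:R * m.
  by rewrite hs; ring.
have h1 : 12%:R * m ^+ 4 <= m ^+ 5.
  by rewrite [m ^+ 5]exprS ler_wpM2r // exprn_ge0 // ltW.
have h2 : 144%:R * m ^+ 3 <= 12%:R * m ^+ 4.
  have : 0 <= m ^+ 3 by rewrite exprn_ge0 // ltW.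
  by rewrite [m ^+ 4]exprS; nra.
have h3 : 0 <= m ^+ 3 by rewrite exprn_ge0 // ltW.
have st : 9%:R / 5%:R * t <= x * t by rewrite ler_wpM2r //; lra.
rewrite mulrA -exprS; lra.
Qed.

Lemma darcais_ge0 (n : nat) x : 9%:R / 5%:R <= x -> 0 <= (darcais R n).[x].
Proof.
move=> hx; apply: le_trans (darcais_ge_cube n x hx).
by rewrite divr_ge0 ?exprn_ge0 ?ler0n.
Qed.

(** * Explicit polynomials of small index *)

Lemma darcais1 x : (darcais R 1).[x] = x.
Proof.
rewrite darcais_rec // big_nat1 subnn darcais0 !hornerE sigmaE /=.
by field.
Qed.

Lemma darcais2 x : (darcais R 2).[x] = x * (x + 3%:R) / 2%:R.
Proof.
rewrite darcais_rec // unlock /= darcais1 darcais0 !hornerE !sigmaE /=.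
by field.
Qed.

Lemma darcais3 x :
  (darcais R 3).[x] = x * (x + 1) * (x + 8%:R) / 6%:R.
Proof.
rewrite darcais_rec // unlock /= darcais2 darcais1 darcais0 !hornerE !sigmaE /=.
by field.
Qed.

Lemma darcais4 x :
  (darcais R 4).[x] = x * (x + 1) * (x + 3%:R) * (x + 14%:R) / 24%:R.
Proof.
rewrite darcais_rec // unlock /= darcais3 darcais2 darcais1 darcais0 !hornerE.
by rewrite !sigmaE /=; field.
Qed.

Lemma darcais5 x :
  (darcais R 5).[x] =
    x * (x + 3%:R) * (x + 6%:R) * (x ^+ 2 + 21%:R * x + 8%:R) / 120%:R.
Proof.
rewrite darcais_rec // unlock /= darcais4 darcais3 darcais2 darcais1 darcais0.
by rewrite !hornerE !sigmaE /=; field.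
Qed.

Lemma darcais6 x :
  (darcais R 6).[x] =
    x * (x + 1) * (x + 10%:R)
    * (x ^+ 3 + 34%:R * x ^+ 2 + 181%:R * x + 144%:R) / 720%:R.
Proof.
rewrite darcais_rec // unlock /= darcais5 darcais4 darcais3 darcais2 darcais1.
by rewrite darcais0 !hornerE !sigmaE /=; field.
Qed.

(** * P_a against values of sigma *)

Lemma darcais_ge1 (n : nat) x : 9%:R / 5%:R <= x -> 1 <= (darcais R n).[x].
Proof.
move=> hx; have [lt_n|ge_n] := ltnP n 12.
  apply: le_trans (darcais_table_le _ _ hx lt_n).
  have : (100 <= nth 0 darcais_table n)%N.
    by do 12 (case: n lt_n => [|n] lt_n; first by vm_compute).
  by rewrite -(@ler_nat R); lra.
apply: le_trans (darcais_ge_cube n x hx).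
have : 12%:R <= n%:R :> R by rewrite ler_nat.
move: n%:R => m m12; rewrite !exprS; nra.
Qed.

(** Since k <= sigma(k) and 2 sigma(m) <= m (m + 1), it suffices that (a + k)(a + k + 1) <= k (a +
    1)(a + 2) for 1 <= k <= a, and that P_a >= (a + 1)(a + 2) / 2. *)
Lemma sigma_shift_le (a k : nat) x : 9%:R / 5%:R <= x -> (3 < a)%N ->
  (0 < k <= a)%N -> (sigma (a + k))%:R <= (sigma k)%:R * (darcais R a).[x].
Proof.
move=> hx a4 /andP[k0 ka].
have Pa : (a.+1 * a.+2)%:R / 2%:R <= (darcais R a).[x].
  have [a5|a5] := ltnP 4 a.
    apply: le_trans (darcais_ge_cube a x hx).
    have : 5%:R <= a%:R :> R by rewrite ler_nat.
    rewrite natrM -(natr1 a.+1) -(natr1 a); move: a%:R => m m5.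
    have m2 : 5%:R * m <= m ^+ 2 by rewrite expr2 ler_wpM2r //; lra.
    have : 5%:R * m ^+ 2 <= m ^+ 3.
      by rewrite [m ^+ 3]exprS ler_wpM2r ?sqr_ge0.
    by lra.
  (* At a = 4 the value to reach is 15: the cubic bound gives only 12.8, the table 15.92. *)
  have -> : a = 4 by lia.
  by apply: le_trans (darcais_table_le 4 x hx isT); rewrite /=; lra.
have hs : (2 * sigma (a + k) <= sigma k * (a.+1 * a.+2))%N.
  apply: leq_trans (sigma_leq _ _) _; first by lia.
  apply: (@leq_trans (k * (a.+1 * a.+2))); first by nia.
  by rewrite leq_mul2r leq_sigma ?orbT.
have {}hs : 2%:R * (sigma (a + k))%:R <= (sigma k)%:R * (a.+1 * a.+2)%:R :> R.
  by rewrite -!natrM ler_nat.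
have : 0 <= (sigma k)%:R :> R by rewrite ler0n.
by move: Pa hs; move: (_ * _)%:R (sigma k)%:R => u s; nra.
Qed.

(* The weights 12/10, 5/10, 12/10 are the bounds of [darcais_mul_sub1]. *)
Lemma sigma_window_lt (a : nat) x : 9%:R / 5%:R <= x ->
  (10 * sigma a.+4.+1 + 12 * sigma a.+3 + 5 * sigma a.+2
   + 12 * sigma a.+1)%:R / 10%:R
  < (darcais R a.+4).[x].
Proof.
(* With n = a + 4, the quadratic bounds on sigma beat 2 n^3 from n = 9 on (1374 < 1458) but not at n
   = 8 (1071 > 1024), so n <= 8 is left to the table. *)
move=> hx; have [lt_a|ge_a] := ltnP a 5.
  apply: lt_le_trans (darcais_table_le a.+4 x hx _); last by lia.
  have : (10 * (10 * sigma a.+4.+1 + 12 * sigma a.+3 + 5 * sigma a.+2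
      + 12 * sigma a.+1) < nth 0 darcais_table a.+4)%N.
    rewrite !sigmaE.
    by do 5 (case: a lt_a => [|a] lt_a; first by vm_compute).
  by rewrite -(@ltr_nat R) natrM; lra.
apply: lt_le_trans (darcais_ge_cube a.+4 x hx).
have : (10 * sigma a.+4.+1 + 12 * sigma a.+3 + 5 * sigma a.+2 + 12 * sigma a.+1
   < 2 * a.+4 ^ 3)%N.
  have := sigma_leq a.+4.+1 isT; have := sigma_leq a.+3 isT.
  have := sigma_leq a.+2 isT; have := sigma_leq a.+1 isT.
  move: (sigma _) (sigma _) (sigma _) (sigma _) => s1 s2 s3 s4.
  have -> : (a.+4 ^ 3 = a.+4 * a.+4 * a.+4)%N by lia.
  by nia.
by rewrite -(@ltr_nat R) [ltRHS]natrM natrX; lra.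
Qed.

(** * Small pairs *)

(** At x = 9/5 the differences are -1.08, -0.456 and -1.1088, and they increase from there. *)
Lemma darcais_mul_sub1 x : 9%:R / 5%:R <= x ->
  [/\ - (6%:R / 5%:R) <=
        (darcais R 1).[x] * (darcais R 1).[x] - (darcais R 2).[x],
      - (1 / 2%:R) <= (darcais R 2).[x] * (darcais R 1).[x] - (darcais R 3).[x]
    & - (6%:R / 5%:R) <=
        (darcais R 3).[x] * (darcais R 1).[x] - (darcais R 4).[x]].
Proof.
move=> hx; rewrite darcais4 darcais3 darcais2 darcais1.
(* In powers of t all coefficients of the inequalities are nonnegative, so they are linear in
   nonnegative monomials. *)
have [t t0 ->] : exists2 t, 0 <= t & x = t + 9%:R / 5%:R.
  by exists (x - 9%:R / 5%:R); [lra | ring].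
have := mulr_ge0 t0 t0; have := mulr_ge0 t0 (mulr_ge0 t0 t0).
have := mulr_ge0 (mulr_ge0 t0 t0) (mulr_ge0 t0 t0).
by split; lra.
Qed.

Lemma darcais_mul_gt22 x : 9%:R / 5%:R <= x ->
  (darcais R 4).[x] < (darcais R 2).[x] * (darcais R 2).[x].
Proof.
move=> hx; rewrite darcais4 darcais2.
have [t t0 ->] : exists2 t, 0 <= t & x = t + 9%:R / 5%:R.
  by exists (x - 9%:R / 5%:R); [lra | ring].
have := mulr_ge0 t0 t0; have := mulr_ge0 t0 (mulr_ge0 t0 t0).
have := mulr_ge0 (mulr_ge0 t0 t0) (mulr_ge0 t0 t0).
by lra.
Qed.

Lemma darcais_mul_gt32 x : 9%:R / 5%:R <= x ->
  (darcais R 5).[x] < (darcais R 3).[x] * (darcais R 2).[x].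
Proof.
move=> hx; rewrite darcais5 darcais3 darcais2.
have [t t0 ->] : exists2 t, 0 <= t & x = t + 9%:R / 5%:R.
  by exists (x - 9%:R / 5%:R); [lra | ring].
have t2 := mulr_ge0 t0 t0; have t3 := mulr_ge0 t0 t2.
have := mulr_ge0 t2 t2; have := mulr_ge0 t2 t3.
by lra.
Qed.

Lemma darcais_mul_gt33 x : 9%:R / 5%:R <= x ->
  (darcais R 6).[x] < (darcais R 3).[x] * (darcais R 3).[x].
Proof.
move=> hx; rewrite darcais6 darcais3.
have [t t0 ->] : exists2 t, 0 <= t & x = t + 9%:R / 5%:R.
  by exists (x - 9%:R / 5%:R); [lra | ring].
have t2 := mulr_ge0 t0 t0; have t3 := mulr_ge0 t0 t2.
have := mulr_ge0 t2 t2; have := mulr_ge0 t2 t3; have := mulr_ge0 t3 t3.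
by lra.
Qed.

(** * The induction *)

(** The hypothesis on smaller pairs is silent when i + j <= 4. Such pairs enter the first sum only
    through D 1, D 2 and D 3, that is at k = a + 3, a + 2 and a + 1, apart from D 0 = 0. *)
Lemma darcais_mul_gt_step (a b : nat) x : 9%:R / 5%:R <= x ->
  (0 < b <= a.+4)%N ->
  (forall i j, (0 < i)%N -> (0 < j)%N -> (4 < i + j < a.+4 + b)%N ->
     (darcais R (i + j)).[x] <= (darcais R i).[x] * (darcais R j).[x]) ->
  (darcais R (a.+4 + b)).[x] < (darcais R a.+4).[x] * (darcais R b).[x].
Proof.
move=> hx /andP[b0 ba] IH.
pose D i := (darcais R i).[x] * (darcais R b).[x] - (darcais R (i + b)).[x].
have D_ge0 i : (0 < i < a.+4)%N -> (4 < i + b)%N -> 0 <= D i.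
  by move=> /andP[i0 ia] ib; rewrite subr_ge0 IH // ib ltn_add2r.
have [d11 d21 d31] := darcais_mul_sub1 x hx.
have d22 := ltW (darcais_mul_gt22 x hx).
have D3_ge : - (6%:R / 5%:R) <= D 3.
  have [lt|ge] := ltnP 4 (3 + b); first by apply: le_trans (D_ge0 3 isT lt); lra.
  by rewrite /D (_ : b = 1) //; lia.
have D2_ge : - (1 / 2%:R) <= D 2.
  have [lt|ge] := ltnP 4 (2 + b); first by apply: le_trans (D_ge0 2 isT lt); lra.
  have [eb|eb] : b = 1 \/ b = 2 by lia.
    by rewrite /D eb.
  by rewrite /D eb; lra.
(* By symmetry D(1, b) = D(b, 1), and -6/5 is the weakest of the bounds for b <= 3. *)
have D1_ge : - (6%:R / 5%:R) <= D 1.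
  have [lt|ge] := ltnP 4 (1 + b); first by apply: le_trans (D_ge0 1 isT lt); lra.
  have [eb|[eb|eb]] : b = 1 \/ b = 2 \/ b = 3 by lia.
  - by rewrite /D eb.
  - by rewrite /D eb; lra.
  - by rewrite /D eb; lra.
have sum1 : - (12 * sigma a.+3 + 5 * sigma a.+2 + 12 * sigma a.+1)%:R / 10%:R <=
    \sum_(1 <= k < a.+4.+1) (sigma k)%:R *
      ((darcais R (a.+4 - k)).[x] * (darcais R b).[x]
       - (darcais R (a.+4 + b - k)).[x]).
  have -> : \sum_(1 <= k < a.+4.+1) (sigma k)%:R *
      ((darcais R (a.+4 - k)).[x] * (darcais R b).[x]
       - (darcais R (a.+4 + b - k)).[x])
    = \sum_(1 <= k < a.+4.+1) (sigma k)%:R * D (a.+4 - k)%N.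
    by apply: eq_big_nat => k /andP[_ ka]; rewrite /D addnBAC.
  do 4 rewrite big_nat_recr //=.
  have -> : (a.+4 - a.+1 = 3)%N by lia.
  have -> : (a.+4 - a.+2 = 2)%N by lia.
  have -> : (a.+4 - a.+3 = 1)%N by lia.
  have D0 : D 0 = 0 by rewrite /D darcais0 hornerC mul1r subrr.
  rewrite subnn D0 mulr0 addr0.
  have : 0 <= \sum_(1 <= k < a.+1) (sigma k)%:R * D (a.+4 - k)%N.
    rewrite big_nat_cond; apply: sumr_ge0 => k /andP[/andP[k0 ka] _].
    by rewrite mulr_ge0 ?ler0n // D_ge0; lia.
  rewrite 2!natrD 3!natrM.
  have : 0 <= (sigma a.+1)%:R :> R by rewrite ler0n.
  have : 0 <= (sigma a.+2)%:R :> R by rewrite ler0n.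
  have : 0 <= (sigma a.+3)%:R :> R by rewrite ler0n.
  move: (sigma _)%:R (sigma _)%:R (sigma _)%:R => u v w.
  by nra.
have sum2 : (darcais R a.+4).[x] - (sigma a.+4.+1)%:R <=
    \sum_(1 <= k < b.+1)
      ((sigma k)%:R * (darcais R a.+4).[x] - (sigma (a.+4 + k))%:R)
      * (darcais R (b - k)).[x].
  have shift k : (0 < k <= b)%N ->
      0 <= (sigma k)%:R * (darcais R a.+4).[x] - (sigma (a.+4 + k))%:R.
    by move=> /andP[k0 kb]; rewrite subr_ge0 sigma_shift_le // k0 (leq_trans kb).
  (* The factor at k = 1 is nonnegative and P_(b-1) >= 1, so this term alone gives the left-hand
     side. *)
  rewrite big_ltn ?ltnS // -[leLHS]addr0 lerD //.
    have := shift 1 b0; rewrite addn1 sigmaE /= addn0 mul1r => s1.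
    by rewrite ler_peMr // darcais_ge1.
  rewrite big_nat_cond; apply: sumr_ge0 => k /andP[/andP[k1 kb] _].
  by rewrite mulr_ge0 ?darcais_ge0 // shift; lia.
have F := sigma_window_lt a x hx.
rewrite -subr_gt0 -(@pmulr_rgt0 _ (a.+4 + b)%:R); last by rewrite ltr0n.
rewrite darcais_sub pmulr_rgt0; last by lra.
rewrite 3!natrD 4!natrM in F; rewrite 2!natrD 3!natrM in sum1.
by lra.
Qed.

Lemma darcais_mul_gt (a b : nat) x : 9%:R / 5%:R <= x ->
  (0 < a)%N -> (0 < b)%N -> (4 < a + b)%N ->
  (darcais R (a + b)).[x] < (darcais R a).[x] * (darcais R b).[x].
Proof.
move=> hx; have [n] := ubnP (a + b); elim: n a b => [//|n IHn] a b.
wlog le_ba : a b / (b <= a)%N => [hwlog|] lt_n a0 b0 ab.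
  have [le_ba|/ltnW le_ab] := leqP b a; first exact: hwlog.
  by rewrite addnC mulrC hwlog // addnC.
(* With b <= a and a + b > 4, a <= 2 is impossible and a = 3 forces b = 2 or 3. *)
case: a le_ba lt_n a0 ab => [|[|[|[|a]]]] le_ba lt_n a0 ab; try lia.
  have [->|->] : b = 2 \/ b = 3 by lia.
    exact: darcais_mul_gt32.
  exact: darcais_mul_gt33.
apply: darcais_mul_gt_step; rewrite ?b0 // => i j i0 j0 /andP[ij lt_ij].
by apply/ltW/IHn => //; lia.
Qed.

End Darcais.

Theorem theorem1p4 (R : realType) (a b : nat) (x : R)
  (ha : (0 < a)%N) (hb : (0 < b)%N) (hab : (4 < a + b)%N)
  (hx : 18%:R / 10%:R < x) :
  (darcais R (a + b)).[x] < (darcais R a).[x] * (darcais R b).[x].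
Proof. by apply: darcais_mul_gt => //; lra. Qed.
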